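(* Let $t\ge 2$ be an integer. If $G$ is a $3$-graph not containing $L_t^3$ as a subgraph, then $\lambda(G)\le \lambda(K_{2t}^{3})$. Furthermore, there is $c_2=c_2(t)>0$ such that if $G$ is a $3$-graph not containing $L_t^3$ as a subgraph, $G$ covers pairs, and $G\ne K_{2t}^3$, then $$\lambda(G)\le \lambda(K_{2t}^{3})-c_2=\frac{(2t-1)(t-1)}{12t^2}-c_2.$$
   Context: An $r$-graph is a vertex set with a family of $r$-element subsets (edges). $K^r_p$ is the complete $r$-graph on $p$ vertices. The linear star $L^r_t$ is the $r$-graph with $t$ edges that all contain a common vertex $x$ and are pairwise disjoint outside $\{x\}$. An $r$-graph covers pairs if every pair of its vertices is contained in some edge. For an $r$-graph $G$ on $[n]$ and $\vec x\in[0,\infty)^n$, $\lambda(G,\vec x)=\sum_{e\in E(G)}\prod_{i\in e}x_i$, and $\lambda(G)=\max\{\lambda(G,\vec x):\vec x\ge0,\ \sum_ix_i=1\}$. *)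

(* Defs.v *)
From HB Require Import structures.
From mathcomp Require Import all_boot all_order all_algebra.
From mathcomp Require Import all_classical all_reals.
From mathcomp Require Import topology normedtype derive.

Set Implicit Arguments.
Unset Strict Implicit.
Unset Printing Implicit Defensive.

Import Order.TTheory GRing.Theory Num.Theory.
Import numFieldTopology.Exports numFieldNormedType.Exports.

Local Open Scope ring_scope.

Record hypergraph := Hypergraph {
  vert : finType;
  edges : {set {set vert}} }.

(* [uniform r G] : G is an r-graph. *)
Definition uniform (r : nat) (G : hypergraph) : Prop :=
  forall e : {set vert G}, e \in edges G -> #|e| = r.

Definition complete (r p : nat) : hypergraph :=
  @Hypergraph 'I_p (finset (fun e : {set 'I_p} => #|e| == r)).

(* [None] is the centre of the star; [Some (i, j)], for j < r - 1, are the
   non-central vertices of its i-th edge. Meaningful for r >= 1. *)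
Definition star_edge (r t : nat) (i : 'I_t) :
    {set option ('I_t * 'I_r.-1)%type} :=
  (None |: finset (fun v => if v is Some (k, _) then k == i else false))%SET.

Definition linear_star (r t : nat) : hypergraph :=
  @Hypergraph (option ('I_t * 'I_r.-1)%type)
    (@star_edge r t @: [set: 'I_t])%SET.

(* [subgraph_of H G] : G contains a (not necessarily induced) copy of H. *)
Definition subgraph_of (H G : hypergraph) : Prop :=
  exists f : vert H -> vert G, injective f /\
    forall e : {set vert H}, e \in edges H -> (f @: e)%SET \in edges G.

Definition isomorphic (G H : hypergraph) : Prop :=
  exists f : vert G -> vert H, bijective f /\
    forall e : {set vert G}, ((f @: e)%SET \in edges H) = (e \in edges G).

Definition covers_pairs (G : hypergraph) : Prop :=
  forall u v : vert G, u != v ->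
    exists e : {set vert G}, [/\ e \in edges G, u \in e & v \in e].

Definition lagrange_poly (R : realType) (G : hypergraph) (x : vert G -> R) : R :=
  \sum_(e in edges G) \prod_(i in e) x i.

Definition simplex (R : realType) (V : finType) : set (V -> R) :=
  [set x | (forall i, 0 <= x i) /\ \sum_i x i = 1]%classic.

(* The supremum is a maximum as soon as G has a vertex: see
   [lagrangian_attained]. For the graph without vertices it is [sup set0 = 0]. *)
Definition lagrangian (R : realType) (G : hypergraph) : R :=
  sup (@lagrange_poly R G @` @simplex R (vert G))%classic.

Lemma complete_uniform (r p : nat) : uniform r (complete r p).
Proof. by move=> e; rewrite inE => /eqP. Qed.

Lemma card_star_edge (r t : nat) (i : 'I_t) :
  (0 < r)%N -> #|@star_edge r t i| = r.
Proof.
case: r => // r _; rewrite /star_edge cardsU1 inE /= add1n; congr _.+1.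
pose h (j : 'I_r) := Some (i, j) : option ('I_t * 'I_r)%type.
have inj_h : injective h by move=> j k [].
transitivity #|(h @: [set: 'I_r])%SET|; last first.
  by rewrite card_imset // cardsT card_ord.
apply: eq_card => -[[k j]|]; rewrite !inE.
  apply/eqP/imsetP => [->|[j' _ [-> _]] //]; by exists j; rewrite ?inE.
by apply/esym/negP => /imsetP[].
Qed.

Lemma linear_star_uniform (r t : nat) :
  (0 < r)%N -> uniform r (linear_star r t).
Proof. by move=> r0 e /imsetP[i _ ->]; exact: card_star_edge. Qed.

Lemma star_edgeI (r t : nat) (i j : 'I_t) : i != j ->
  (@star_edge r t i :&: @star_edge r t j)%SET = [set None]%SET.
Proof.
move=> ij; apply/setP => -[[k l]|]; rewrite !inE //=.
by apply/negP => /andP[/eqP-> /eqP e]; rewrite e eqxx in ij.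
Qed.

Lemma card_linear_star (r t : nat) :
  (1 < r)%N -> #|edges (linear_star r t)| = t.
Proof.
move=> r1; rewrite /= card_imset ?cardsT ?card_ord // => i j eij.
apply/eqP/negPn/negP => /(@star_edgeI r t).
rewrite eij finset.setIid => /(congr1 (fun A : {set _} => #|A|)).
by rewrite cards1 card_star_edge ?(ltnW r1) // => e; rewrite e in r1.
Qed.

Lemma coord_continuous (R : realType) (V : finType) (i : V) :
  continuous (fun x : {ptws V -> R} => x i : R).
Proof. exact: (@proj_continuous V (fun _ => R) i). Qed.

Lemma simplex_compact (R : realType) (V : finType) :
  compact (@simplex R V : set {ptws V -> R}).
Proof.
have cube := @tychonoff V (fun=> R) (fun=> `[0 : R, 1]%classic)
  (fun=> @segment_compact R 0 1).
have csum : continuous (fun x : {ptws V -> R} => \sum_i x i : R).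
  apply: continuous_big => [|i _]; [exact: add_continuous|].
  exact: coord_continuous.
have := compact_closedI cube (proj1 (continuous_closedP _) csum _ (@closed_eq R 1)).
congr compact; apply/seteqP; split => [x [xc x1]|x [x0 x1]] /=; split => // i.
  by have := xc i; rewrite /= in_itv /= => /andP[].
by rewrite /= in_itv /= x0 /= -x1 (bigD1 i) //= lerDl; exact: sumr_ge0.
Qed.

Lemma lagrange_poly_continuous (R : realType) (G : hypergraph) :
  continuous (@lagrange_poly R G : {ptws vert G -> R} -> R).
Proof.
apply: continuous_big => [|e _]; first exact: add_continuous.
apply: continuous_big => [|i _]; first exact: mul_continuous.
exact: coord_continuous.
Qed.

Lemma lagrangian_attained (R : realType) (G : hypergraph) (v : vert G) :
  exists x : vert G -> R, [/\ simplex x, @lagrange_poly R G x = lagrangian R G &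
    forall y : vert G -> R, simplex y -> @lagrange_poly R G y <= @lagrange_poly R G x].
Proof.
have s0 : (@simplex R (vert G) !=set0)%classic.
  exists (fun i => (i == v)%:R); split=> [i|]; first exact: ler0n.
  rewrite (bigD1 v) //= eqxx big1 ?addr0 // => i /negPf -> //.
have [x xS xmax] := @compact_EVT_max {ptws vert G -> R} R (@lagrange_poly R G) _ s0 (@simplex_compact R (vert G))
  (continuous_subspaceT (@lagrange_poly_continuous R G)).
have {}xS : simplex x := set_mem xS.
have ub (y : vert G -> R) : simplex y -> @lagrange_poly R G y <= @lagrange_poly R G x.
  by move=> yS; exact: (xmax y (mem_set yS)).
exists x; split=> //; apply/eqP; rewrite eq_le; apply/andP; split.
  apply: ub_le_sup; last by exists x.
  by exists (@lagrange_poly R G x) => _ [y yS <-]; exact: ub.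
apply: ge_sup; first by exists (@lagrange_poly R G x), x.
by move=> _ [y yS <-]; exact: ub.
Qed.

(* Main.v *)
(* Let x be an optimal weighting of an L_t-free 3-graph G, put z = 2t x and let i
   be a vertex of maximum weight a = z_i. Optimality at i gives
   24 t^2 lambda(G) <= Q, where Q is twice the Lagrange polynomial at z of the
   link of i, a graph without a matching of size t. Compressing the link towards
   heavy vertices keeps this property and does not decrease Q; a compressed graph
   without a t-matching is contained, for some s < t, in the graph in which the s
   heaviest vertices are joined to everything and the 2t - 1 - s heaviest ones
   form a clique. As the other weights are at most a and sum to 2t - a, this
   yields Q <= (2t - 2)(2t - 1), with a loss of at least 1 when s > 0. When s = 0
   and Q is nearly maximal, z is nearly 1 on a set W of 2t vertices and the rest
   is negligible: either W misses a triple, which costs a constant, or W is a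
   clique, which together with one edge leaving W would contain L_t, so that
   covering pairs forces G = K_2t. *)
Require Import Defs.
From mathcomp Require Import all_boot all_order all_algebra.
From mathcomp Require Import all_fingroup.
From mathcomp Require Import all_classical all_reals.
From mathcomp Require Import zify ring lra.

Set Implicit Arguments.
Unset Strict Implicit.
Unset Printing Implicit Defensive.

Import Order.TTheory GRing.Theory Num.Theory.

Local Open Scope ring_scope.

(** * Matchings, quadratic forms and compression of graphs *)

(** Injectivity of [M] on all pairs makes the [m] edges disjoint. The index type is that of the
    non-central vertices of [linear_star 3 m], so a matching in a link is directly a star. *)
Definition has_matching (T : Type) (m : nat) (e : T -> T -> bool) : Prop :=
  exists M : ('I_m * 'I_2)%type -> T,
    injective M /\ forall c, e (M (c, ord0)) (M (c, ord_max)).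

Definition quad_form (R : realType) (T : finType) (e : rel T) (z : T -> R) : R :=
  \sum_x \sum_y (e x y)%:R * (z x * z y).

(** The pair of [i] and [j] itself is excluded, so a compression leaves it in place. *)
Definition touches_only (T : eqType) (i j x y : T) : bool :=
  ((x == i) || (y == i)) && ~~ ((x == j) || (y == j)).

(* The compression of extremal set theory: an edge at [j] is moved to [i]
   whenever that edge at [i] is missing. *)
Definition shift (T : finType) (i j : T) (e : rel T) : rel T := fun x y =>
  let e' := e (tperm i j x) (tperm i j y) in
  if touches_only i j x y then e x y || e'
  else if touches_only j i x y then e x y && e' else e x y.

Section Shifting.

Variables (T : finType) (i j : T) (e : rel T).
Hypotheses (e_sym : symmetric e) (e_irr : irreflexive e).

Lemma touches_onlyC (a b x y : T) : touches_only a b x y = touches_only a b y x.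
Proof. by rewrite /touches_only orbC (orbC (x == b)). Qed.

Lemma touches_only_tperm (x y : T) :
  touches_only i j (tperm i j x) (tperm i j y) = touches_only j i x y.
Proof.
have E a b : (tperm i j a == b) = (a == tperm i j b).
  by rewrite -{1}(tpermK i j b) (inj_eq (@perm_inj _ _)).
by rewrite /touches_only !E tpermL tpermR.
Qed.

Lemma shift_sym : symmetric (shift i j e).
Proof.
move=> x y; rewrite /shift (touches_onlyC i j y x) (touches_onlyC j i y x) (e_sym y x).
by rewrite (e_sym (tperm i j y)).
Qed.

Lemma shift_irr : irreflexive (shift i j e).
Proof. by move=> x; rewrite /shift !e_irr; case: ifP => // _; case: ifP. Qed.

(* Either the matching itself or its image under the transposition of [i] and
   [j] survives. *)
Lemma shift_matching (m : nat) :
  has_matching m (shift i j e) -> has_matching m e.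
Proof.
case=> M [Minj Me].
case: (pselect (forall c, e (M (c, ord0)) (M (c, ord_max)))) => [H|].
  by exists M.
move=> /existsNP [c0 /negP nc0].
(* An edge of the shifted graph that is missing from [e] must have been moved to [i]. *)
have touch0 : touches_only i j (M (c0, ord0)) (M (c0, ord_max)).
  move: (Me c0) nc0; rewrite /shift; case: ifP => // _.
  by case: ifP => [_ /andP[-> //]|_ ->].
exists (fun p => tperm i j (M p)); split.
  by move=> p q /perm_inj /Minj.
move=> c; case: (eqVneq c c0) => [->|ne].
  by move: (Me c0) nc0; rewrite /shift touch0 => /orP[->|].
(* By injectivity only the edge [c0] uses [i]. Another edge through [j] survives the shift only if
   its mirror image is in [e]; one that avoids [j] as well is fixed by the transposition. *)
have noti a : M (c, a) != i.
  apply/eqP => E; move: touch0 => /andP[/orP[|] /eqP F _];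
    by move: ne; rewrite -F in E; case: (Minj _ _ E) => -> _; rewrite eqxx.
move: (Me c); rewrite /shift /touches_only !(negPf (noti _)) /= andbT.
case: ifP => [_ /andP[] //|/norP[n0 n1]].
by rewrite !tpermD // eq_sym.
Qed.

(** A moved edge appears at its new place and disappears from the mirror image under [tau];
    reindexing the losses by [tau] pairs each of them with its gain. *)
Lemma quad_form_shift (R : realType) (w : T -> R) :
  let tau := tperm i j in
  quad_form (shift i j e) w = quad_form e w +
    \sum_x \sum_y [&& touches_only i j x y, ~~ e x y & e (tau x) (tau y)]%:R *
      (w x * w y - w (tau x) * w (tau y)).
Proof.
move=> tau; rewrite /quad_form !pair_big /=.
pose gain x y := [&& touches_only i j x y, ~~ e x y & e (tau x) (tau y)].
have E x y : (shift i j e x y)%:R =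
    (e x y)%:R + (gain x y)%:R - (gain (tau x) (tau y))%:R :> R.
  rewrite /shift /gain touches_only_tperm !tpermK -/tau.
  have := touches_only_tperm x y; rewrite /touches_only.
  case: (x == i); case: (y == i); case: (x == j); case: (y == j) => //= _;
  case: (e x y); case: (e (tau x) (tau y)) => /=; lra.
under eq_bigr do rewrite E mulrBl mulrDl.
rewrite sumrB big_split /= -addrA; congr (_ + _).
rewrite [X in _ - X](reindex_inj (h := fun p => (tau p.1, tau p.2))) /=; last first.
  by case=> x y [x' y'] /= [/perm_inj -> /perm_inj ->].
under [X in _ - X]eq_bigr do rewrite !tpermK.
by rewrite -sumrB; apply: eq_bigr => p _; rewrite mulrBr.
Qed.

Lemma quad_form_shift_gain_ge0 (R : realType) (w : T -> R) (x y : T) :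
  (forall v, 0 <= w v) -> w j <= w i ->
  0 <= [&& touches_only i j x y, ~~ e x y & e (tperm i j x) (tperm i j y)]%:R *
      (w x * w y - w (tperm i j x) * w (tperm i j y)).
Proof.
move=> w0 wij; case: (boolP [&& _, _ & _]) => [|_]; last by rewrite mul0r.
case/and3P=> /andP[/orP[]/eqP-> /norP[n1 n2]] ne et; rewrite mul1r subr_ge0.
  have nyi : y != i by apply: contraTneq et => ->; rewrite e_irr.
  by rewrite tpermL tpermD 1?eq_sym // ler_wpM2r.
have nxi : x != i by apply: contraTneq et => ->; rewrite e_irr.
by rewrite tpermL tpermD 1?eq_sym // ler_wpM2l.
Qed.

Lemma quad_form_shift_ge (R : realType) (w : T -> R) :
  (forall v, 0 <= w v) -> w j <= w i ->
  quad_form e w <= quad_form (shift i j e) w.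
Proof.
move=> w0 wij; rewrite quad_form_shift lerDl.
by do 2 (apply: sumr_ge0 => ? _); exact: quad_form_shift_gain_ge0.
Qed.

(** Strict growth replaces a termination argument: a graph that is maximal for positive, strictly
    decreasing weights cannot be compressed further. *)
Lemma quad_form_shift_gt (R : realType) (w : T -> R) (x : T) :
  (forall v, 0 < w v) -> w j < w i -> x != i -> x != j ->
  e j x -> ~~ e i x -> quad_form e w < quad_form (shift i j e) w.
Proof.
move=> w0 wij xi xj ejx eix; rewrite quad_form_shift ltrDl.
have ge a b := @quad_form_shift_gain_ge0 R w a b (fun v => ltW (w0 v)) (ltW wij).
rewrite (bigD1 i) //= (bigD1 x) //= ltr_pwDl ?sumr_ge0 //; last first.
  by move=> a _; exact: sumr_ge0.
rewrite ltr_pwDl ?sumr_ge0 // /touches_only eqxx (negPf xj).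
have nij : i != j by apply: contraTneq wij => ->; rewrite ltxx.
rewrite (negPf nij) /= tpermL tpermD 1?eq_sym // eix ejx /= mul1r -mulrBl.
by rewrite mulr_gt0 // subr_gt0.
Qed.

End Shifting.

Lemma eq_has_matching (T : finType) (m : nat) (e e' : rel T) :
  e =2 e' -> has_matching m e -> has_matching m e'.
Proof. by move=> E [M [Mi Me]]; exists M; split=> // c; rewrite -E. Qed.

(** * Left-compressed graphs without a large matching *)

Definition stable (N : nat) (e : rel 'I_N) : Prop :=
  forall i j x : 'I_N, (i < j)%N -> x != i -> x != j -> e j x -> e i x.

(** Instead of iterating compressions, take a graph maximising an auxiliary form among those with
    the wanted properties; an unstable one could be compressed with strict gain. *)
Lemma exists_stable (R : realType) (N m : nat) (e : rel 'I_N) (z : 'I_N -> R) :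
  symmetric e -> irreflexive e -> ~ has_matching m e ->
  (forall v, 0 <= z v) -> (forall a b : 'I_N, (a <= b)%N -> z b <= z a) ->
  exists e' : rel 'I_N, [/\ symmetric e', irreflexive e', ~ has_matching m e',
    stable e' & quad_form e z <= quad_form e' z].
Proof.
move=> e_sym e_irr e_nm z0 zdec.
(* Relations are coded by edge sets, which form a finite type over which a maximum can be taken. *)
pose relof (E : {set 'I_N * 'I_N}) : rel 'I_N := fun x y => (x, y) \in E.
pose setof (f : rel 'I_N) : {set 'I_N * 'I_N} := finset (fun p => f p.1 p.2).
have relofK f : relof (setof f) =2 f by move=> x y; rewrite /relof inE.
pose good E := `[< [/\ symmetric (relof E), irreflexive (relof E),
  ~ has_matching m (relof E) & quad_form e z <= quad_form (relof E) z] >].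
have qE f w : quad_form (relof (setof f)) w = quad_form f w :> R.
  by apply: eq_bigr => x _; apply: eq_bigr => y _; rewrite relofK.
have goodset f : symmetric f -> irreflexive f -> ~ has_matching m f ->
    quad_form e z <= quad_form f z -> good (setof f).
  move=> fs fi fm fq; apply/asboolP; split.
  - by move=> x y; rewrite !relofK.
  - by move=> x; rewrite relofK.
  - by move/(eq_has_matching (relofK f)).
  - by rewrite qE.
(* [z] may have ties or zeros and then miss a compression; these weights are positive and strictly
   decreasing. *)
pose w (x : 'I_N) : R := (N - x)%:R.
have w0 v : 0 < w v by rewrite ltr0n subn_gt0.
have [E /asboolP [Es Ei Em Eq] Emax] :=
  @arg_maxP _ R _ (setof e) good (fun E => quad_form (relof E) w)
    (goodset e e_sym e_irr e_nm (lexx _)).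
exists (relof E); split=> // i j x ij xi xj ejx; apply/negPn/negP => eix.
have wij : w j < w i by rewrite ltr_nat; have := ltn_ord j; lia.
have := quad_form_shift_gt Ei w0 wij xi xj ejx eix.
rewrite ltNge => /negP; apply; rewrite -qE; apply: Emax; apply: goodset.
- exact: shift_sym.
- exact: shift_irr.
- by move/shift_matching.
- by apply: (le_trans Eq); apply: quad_form_shift_ge => //; apply: zdec; exact: ltnW.
Qed.

(** The nested pairs [(c, 2k + 1 - c)] with [c <= k] are disjoint, so one of them is not an edge;
    stability then excludes every edge above it in both coordinates, and [s] is that [c]. *)
Lemma stable_no_matching (N k : nat) (e : rel 'I_N) :
  (2 * k + 2 <= N)%N -> symmetric e -> stable e -> ~ has_matching k.+1 e ->
  exists2 s : nat, (s <= k)%N & forall a b : 'I_N, (a < b)%N -> e a b ->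
    (a < s)%N || (b < 2 * k + 1 - s)%N.
Proof.
move=> kN es st nm.
have lo (c : 'I_k.+1) : (c < N)%N by have := ltn_ord c; lia.
have hi (c : 'I_k.+1) : (2 * k + 1 - c < N)%N by have := ltn_ord c; lia.
pose M (p : 'I_k.+1 * 'I_2) : 'I_N :=
  if p.2 == ord0 then Ordinal (lo p.1) else Ordinal (hi p.1).
have Minj : injective M.
  move=> [c b] [c' b'] /(congr1 val); rewrite /M /=.
  have := ltn_ord c; have := ltn_ord c'.
  case: (eqVneq b ord0) => [->|bn]; case: (eqVneq b' ord0) => [->|bn'] /= l l' E.
  - by congr pair; apply: val_inj.
  - by exfalso; lia.
  - by exfalso; lia.
  - congr pair; apply: val_inj => /=; first lia.
    have := ltn_ord b; have := ltn_ord b'; move: bn bn'; rewrite -!val_eqE /=; lia.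
have [c nc] : exists c, ~~ e (Ordinal (lo c)) (Ordinal (hi c)).
  apply/existsP; rewrite -negb_forall; apply/negP => /forallP H.
  by apply: nm; exists M; split=> // c; exact: H.
have ck := ltn_ord c.
exists c => [|a b ab eab]; first lia.
rewrite -[_ || _]negbK; apply/negP => /norP[]; rewrite -!leqNgt => ca cb.
move/negP: nc; apply.
(* One endpoint is lowered from [a] to [c], then the other from [b] to [2k + 1 - c]. *)
have ecb : e (Ordinal (lo c)) b.
  move: ca; rewrite leq_eqVlt => /orP[/eqP E|ca].
    by rewrite (_ : Ordinal _ = a) //; apply: val_inj.
  by apply: (st _ a) => //; rewrite -val_eqE /=; lia.
rewrite es; move: cb; rewrite leq_eqVlt => /orP[/eqP E|cb].
  by rewrite es (_ : Ordinal (hi c) = b) //; apply: val_inj.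
by apply: (st _ b) => //; rewrite 1?es // -val_eqE /=; lia.
Qed.

(** * Quadratic forms of graphs without a large matching *)

(** Cauchy-Schwarz, by expanding the sum of the squares of [#|P| * y x - S]. *)
Lemma sqr_sum_le (R : realType) (T : finType) (P : {set T}) (y : T -> R) :
  (\sum_(x in P) y x) ^+ 2 <= #|P|%:R * \sum_(x in P) y x ^+ 2.
Proof.
set S := \sum_(x in P) y x; set S2 := \sum_(x in P) y x ^+ 2.
have [P0|Pn0] := posnP #|P|.
  by rewrite /S; move/eqP: P0; rewrite cards_eq0 => /eqP ->; rewrite big_set0 expr0n cards0 mul0r.
have p0 : 0 < #|P|%:R :> R by rewrite ltr0n.
have : 0 <= \sum_(x in P) (#|P|%:R * y x - S) ^+ 2 by apply: sumr_ge0 => *; exact: sqr_ge0.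
have E x : (#|P|%:R * y x - S) ^+ 2 =
    #|P|%:R ^+ 2 * y x ^+ 2 + (- 2 * #|P|%:R * S * y x + S ^+ 2) by ring.
under eq_bigr do rewrite E.
rewrite !big_split /= -!mulr_sumr sumr_const -/S -/S2 -mulr_natl => H.
rewrite -subr_ge0 -(pmulr_rge0 _ p0); apply: le_trans H _; rewrite le_eqVlt.
by apply/orP; left; apply/eqP; ring.
Qed.

(** The right-hand side is the form of the graph of all pairs that meet [P] or lie inside [B]; the
    subtracted sums of squares remove the loops. *)
Lemma quad_form_le_split (R : realType) (T : finType) (e : rel T) (y : T -> R)
    (P B : {set T}) :
  (forall x, 0 <= y x) -> irreflexive e -> [disjoint P & B] ->
  (forall u v, e u v -> [|| u \in P, v \in P | (u \in B) && (v \in B)]) ->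
  quad_form e y <=
    (\sum_(x in P) y x) ^+ 2 +
    2 * (\sum_(x in P) y x) * (\sum_x y x - \sum_(x in P) y x) +
    (\sum_(x in B) y x) ^+ 2 - \sum_(x in P) y x ^+ 2 - \sum_(x in B) y x ^+ 2.
Proof.
move=> y0 ei dis eP.
pose p x : R := (x \in P)%:R * y x; pose b x : R := (x \in B)%:R * y x.
have sumE (D : {set T}) (f : T -> R) : \sum_(x in D) f x = \sum_x (x \in D)%:R * f x.
  rewrite big_mkcond; apply: eq_bigr => x _.
  by case: (x \in D); rewrite ?mul1r ?mul0r.
(* Inclusion-exclusion for the pairs meeting [P], plus the pairs inside [B], minus the diagonal. *)
pose F u v : R := p u * y v + y u * p v - p u * p v + b u * b v
   - (u == v)%:R * ((u \in P)%:R * (y u ^+ 2) + (u \in B)%:R * (y u ^+ 2)).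
have H : quad_form e y <= \sum_u \sum_v F u v.
  apply: ler_sum => u _; apply: ler_sum => v _; rewrite /F /p /b.
  have yy : 0 <= y u * y v by exact: mulr_ge0.
  case: (eqVneq u v) => [<-|nuv].
    rewrite ei; have := disjointFr dis (x := u).
    by case: (u \in P) => [/(_ isT) ->|_]; last (case: (u \in B)); rewrite /=; lra.
  have := eP u v; case: (e u v) => [/(_ isT)|_].
    by case: (u \in P); case: (v \in P); case: (u \in B); case: (v \in B) => //= _; lra.
  by case: (u \in P); case: (v \in P); case: (u \in B); case: (v \in B) => //=; lra.
apply: le_trans H _; rewrite le_eqVlt; apply/orP; left; apply/eqP.
rewrite !sumE.
have E1 (f g : T -> R) : \sum_u \sum_v f u * g v = (\sum_u f u) * (\sum_v g v).
  by rewrite mulr_suml; apply: eq_bigr => u _; rewrite mulr_sumr.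
have E2 (f : T -> R) : \sum_u \sum_v (u == v)%:R * f u = \sum_u f u.
  apply: eq_bigr => u _; rewrite (bigD1 u) //= eqxx mul1r big1 ?addr0 // => v.
  by rewrite eq_sym => /negPf ->; rewrite mul0r.
have -> : \sum_u \sum_v F u v =
    \sum_u \sum_v p u * y v + \sum_u \sum_v y u * p v - \sum_u \sum_v p u * p v
    + \sum_u \sum_v b u * b v
    - \sum_u \sum_v (u == v)%:R * ((u \in P)%:R * (y u ^+ 2) + (u \in B)%:R * (y u ^+ 2)).
  rewrite /F; under eq_bigr do rewrite sumrB big_split sumrB big_split /=.
  by rewrite sumrB big_split sumrB big_split.
rewrite !E1 E2 big_split /=; ring.
Qed.

(* Here [A], [A2] are the sum and the sum of squares of the weights of the [s]
   dominating vertices, [B], [B2] those of the remaining [b] clique vertices, [T]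
   is the total weight and [a] a cap on each weight. *)
Lemma threshold_le (R : realType) (s k b A A2 B B2 T a : R) :
  0 <= a -> 0 <= A -> 0 <= B -> A + B <= T -> 1 <= s -> s <= k ->
  T = 2 * k + 2 - a -> b = 2 * k + 1 - 2 * s ->
  A ^+ 2 <= s * A2 -> B ^+ 2 <= b * B2 -> A <= s * a -> B <= b * a ->
  A ^+ 2 + 2 * A * (T - A) + B ^+ 2 - A2 - B2 <= 2 * k * (2 * k + 1) - 1.
Proof.
move=> a0 A0 B0 ABT s1 sk TE bE AA2 BB2 Aa Ba.
set X := (X in X <= _).
have b1 : 1 <= b by rewrite bE; lra.
(* Small cap: [A] and [B] are at most half of [s] and [b], which leaves ample room. *)
have [a2|a2] := leP a (1/2).
  have As : A <= s / 2 by apply: le_trans Aa _; nra.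
  have Bb : B <= b / 2 by apply: le_trans Ba _; nra.
  have HB : B ^+ 2 - B2 <= b * (b - 1) / 4.
    have : b * (B ^+ 2 - B2) <= b * (b * (b - 1) / 4); last by rewrite ler_pM2l //; lra.
    have B2b : B ^+ 2 <= (b / 2) ^+ 2 by rewrite ler_sqr ?nnegrE; lra.
    have : (b - 1) * B ^+ 2 <= (b - 1) * (b / 2) ^+ 2 by rewrite ler_wpM2l //; lra.
    lra.
  have A20 : 0 <= A2 by nra.
  have AT : A * T <= s / 2 * (2 * k + 2) by rewrite ler_pM //; lra.
  have : 0 <= A ^+ 2 by exact: sqr_ge0.
  have : 0 <= (k - s) * (k + s) by rewrite mulr_ge0; lra.
  have k1 : 1 <= k ^+ 2 by nra.
  rewrite /X; rewrite bE in HB; nra.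
(* Large cap, so [T <= 2k + 1]. Enlarging [B] to [T - A] and averaging over [s + b <= 2k] vertices
   gives [X <= (1 - 1/(s + b)) T^2] by convexity of the square. *)
have [a1|/ltW a1] := leP 1 a.
  have sn0 : s != 0 by rewrite gt_eqF //; lra.
  have bn0 : b != 0 by rewrite gt_eqF //; lra.
  pose al := A / s; pose u := (T - A) / b; pose be := B / b.
  have AE : A = s * al by rewrite /al mulrCA divff // mulr1.
  have UE : T - A = b * u by rewrite /u mulrCA divff // mulr1.
  have BE : B = b * be by rewrite /be mulrCA divff // mulr1.
  have A2l : s * al ^+ 2 <= A2.
    rewrite -(@ler_pM2l _ s) ?(lt_le_trans ltr01) //.
    by rewrite (_ : s * (s * _) = A ^+ 2) // AE; ring.
  have B2l : b * be ^+ 2 <= B2.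
    rewrite -(@ler_pM2l _ b) ?(lt_le_trans ltr01) //.
    by rewrite (_ : b * (b * _) = B ^+ 2) // BE; ring.
  have be0 : 0 <= be by rewrite /be divr_ge0 //; lra.
  have beu : be <= u by rewrite /be /u ler_pM2r ?invr_gt0; lra.
  have bsq : be ^+ 2 <= u ^+ 2 by rewrite ler_sqr ?nnegrE //; lra.
  have X1 : X <= T ^+ 2 - s * al ^+ 2 - b * u ^+ 2.
    have : (b ^+ 2 - b) * be ^+ 2 <= (b ^+ 2 - b) * u ^+ 2.
      by rewrite ler_wpM2l //; nra.
    have TE' : T = s * al + b * u by lra.
    rewrite /X UE TE' BE {1 2}AE; nra.
  have m0 : 0 < s + b by lra.
  have X2 : (s + b) * X <= (s + b - 1) * T ^+ 2.
    have : (s + b) * X <= (s + b) * (T ^+ 2 - s * al ^+ 2 - b * u ^+ 2) by rewrite ler_pM2l.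
    have TE' : T = s * al + b * u by lra.
    have : 0 <= s * b * (al - u) ^+ 2 by rewrite mulr_ge0 ?sqr_ge0 // mulr_ge0; lra.
    by rewrite TE'; nra.
  have T2 : T ^+ 2 <= (2 * k + 1) ^+ 2 by rewrite ler_sqr ?nnegrE; lra.
  have X3 : (s + b) * X <= (s + b - 1) * (2 * k + 1) ^+ 2.
    by apply: le_trans X2 _; rewrite ler_wpM2l //; lra.
  rewrite -(ler_pM2l m0); apply: le_trans X3 _.
  have m2k : s + b <= 2 * k by rewrite bE; lra.
  by nra.
(* Middle range: the bound is the one at [A = s] and [B = b], and the lost unit comes from
   [2 * s * a >= 1]. *)
have As : A <= s by apply: le_trans Aa _; nra.
have Bb : B <= b by apply: le_trans Ba _; nra.
have HB : B ^+ 2 - B2 <= b * (b - 1).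
  have : b * (B ^+ 2 - B2) <= b * (b * (b - 1)); last by rewrite ler_pM2l //; lra.
  have B2b : B ^+ 2 <= b ^+ 2 by rewrite ler_sqr ?nnegrE; lra.
  have : (b - 1) * B ^+ 2 <= (b - 1) * b ^+ 2 by rewrite ler_wpM2l //; lra.
  lra.
have HA : 2 * A * T - A ^+ 2 - A2 <= 2 * s * T - s ^+ 2 - s.
  have : s * (2 * A * T - A ^+ 2 - A2) <= s * (2 * s * T - s ^+ 2 - s); last by rewrite ler_pM2l //; lra.
  have : 0 <= (s - A) * (2 * s * T - (s + 1) * (s + A)).
    by rewrite mulr_ge0 //; [lra|rewrite TE; nra].
  lra.
have sa : s * a >= 1/2 by nra.
rewrite /X; have : 0 <= s * (4 * k - 1 - 3 * s) by rewrite mulr_ge0 //; lra.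
move: HA; rewrite TE; rewrite bE in HB; nra.
Qed.

Lemma card_ord_interval_le (N p q : nat) :
  (#|[set x : 'I_N | (p <= x < q)%N]| <= q - p)%N.
Proof.
rewrite -[leqRHS](size_iota p) cardE -(size_map val).
apply: uniq_leq_size; first by rewrite map_inj_uniq ?enum_uniq //; exact: val_inj.
move=> _ /mapP[x + ->]; rewrite mem_enum inE mem_iota => /andP[px xq].
by rewrite px /= subnKC // (leq_trans px (ltnW xq)).
Qed.

Lemma sum_le_card (R : realType) (T : finType) (P : {set T}) (y : T -> R) (a : R) (m : nat) :
  0 <= a -> (forall x, y x <= a) -> (#|P| <= m)%N -> \sum_(x in P) y x <= m%:R * a.
Proof.
move=> a0 ya Pm; apply: (@le_trans _ _ (#|P|%:R * a)).
  by rewrite mulr_natl -sumr_const; apply: ler_sum.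
by rewrite ler_wpM2r // ler_nat.
Qed.

Lemma sqr_sum_le_card (R : realType) (T : finType) (P : {set T}) (y : T -> R) (m : nat) :
  (#|P| <= m)%N -> (\sum_(x in P) y x) ^+ 2 <= m%:R * \sum_(x in P) y x ^+ 2.
Proof.
move=> Pm; apply: le_trans (sqr_sum_le P y) _.
by rewrite ler_wpM2r ?ler_nat // sumr_ge0 // => *; exact: sqr_ge0.
Qed.

(** In the application [a] is the weight of the vertex whose link is taken, hence the total
    [2k + 2 - a]. After compression a dominating vertex costs a unit; without one, all edges lie
    among the [2k + 1] heaviest vertices, where the cap and Cauchy-Schwarz give the last two
    bounds. *)
Lemma quad_form_no_matching (R : realType) (N k : nat) (e : rel 'I_N)
    (y : 'I_N -> R) (a : R) :
  (0 < k)%N -> (2 * k + 2 <= N)%N -> symmetric e -> irreflexive e ->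
  ~ has_matching k.+1 e ->
  (forall x, 0 <= y x <= a) -> (forall u v : 'I_N, (u <= v)%N -> y v <= y u) ->
  \sum_x y x = 2 * k%:R + 2 - a ->
  quad_form e y <= 2 * k%:R * (2 * k%:R + 1) - 1 \/
  quad_form e y <= 2 * k%:R * (2 * k%:R + 1) * a ^+ 2 /\
  (2 * k%:R + 1) * quad_form e y <=
    2 * k%:R * (\sum_(x : 'I_N | (x < 2 * k + 1)%N) y x) ^+ 2.
Proof.
move=> k0 kN es ei em y0a ydec ysum.
have y0 x : 0 <= y x by case/andP: (y0a x).
have ya x : y x <= a by case/andP: (y0a x).
have a0 : 0 <= a.
  have N0 : (0 < N)%N by lia.
  exact: le_trans (y0 (Ordinal N0)) (ya _).
have [e' [es' ei' em' st qe]] := exists_stable es ei em y0 ydec.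
have [s sk Hs] := stable_no_matching kN es' st em'.
pose P : {set 'I_N} := [set x : 'I_N | (0 <= x < s)%N].
pose B : {set 'I_N} := [set x : 'I_N | (s <= x < 2 * k + 1 - s)%N].
have Pc : (#|P| <= s)%N by rewrite -[leqRHS]subn0; exact: card_ord_interval_le.
have Bc : (#|B| <= 2 * k + 1 - 2 * s)%N.
  by rewrite (_ : 2 * k + 1 - 2 * s = 2 * k + 1 - s - s)%N; [exact: card_ord_interval_le|lia].
have dis : [disjoint P & B].
  by rewrite -setI_eq0; apply/eqP/setP => x; rewrite !inE; lia.
have eP u v : e' u v -> [|| u \in P, v \in P | (u \in B) && (v \in B)].
  rewrite !inE => euv; case: (ltngtP u v) => uv.
  - by have := Hs u v uv euv; lia.
  - by have := Hs v u uv; rewrite es' => /(_ euv); lia.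
  - by move: euv; rewrite (val_inj uv) ei'.
have {qe}Q := le_trans qe (quad_form_le_split y0 ei' dis eP).
have PA2 := sqr_sum_le_card y Pc; have BB2 := sqr_sum_le_card y Bc.
have PA := sum_le_card a0 ya Pc; have BA := sum_le_card a0 ya Bc.
set A := \sum_(x in P) y x in Q PA2 PA; set A2 := \sum_(x in P) y x ^+ 2 in Q PA2.
set b := \sum_(x in B) y x in Q BB2 BA; set B2 := \sum_(x in B) y x ^+ 2 in Q BB2.
set T := \sum_x y x in ysum Q.
have A0 : 0 <= A by exact: sumr_ge0.
have b0 : 0 <= b by exact: sumr_ge0.
have AbT : A + b <= T.
  rewrite /A /b [X in X + _]big_mkcond [X in _ + X]big_mkcond -big_split /=.
  apply: ler_sum => x _; have := disjointFr dis (x := x); have := y0 x.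
  by case: (x \in P) => [_ /(_ isT) ->|+ _]; last case: (x \in B); lra.
have [s0|s0] := posnP s; last first.
  left; apply: le_trans Q _.
  apply: (@threshold_le _ s%:R k%:R (2 * k + 1 - 2 * s)%:R A A2 b B2 T a) => //.
  - by rewrite ler1n.
  - by rewrite ler_nat.
  - by rewrite natrB; [rewrite natrD !natrM|lia].
right.
have P0 : P = finset.set0 by apply/setP => x; rewrite !inE s0.
have A00 : A = 0 by rewrite /A P0 big_set0.
have A20 : A2 = 0 by rewrite /A2 P0 big_set0.
have bE : \sum_(x : 'I_N | (x < 2 * k + 1)%N) y x = b.
  by apply: eq_bigl => x; rewrite !inE s0 subn0.
have mE : (2 * k + 1 - 2 * s)%:R = 2 * k%:R + 1 :> R.
  by rewrite s0 muln0 subn0 natrD natrM.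
rewrite bE; rewrite mE in BB2 BA; rewrite A00 A20 in Q.
have k1 : 1 <= k%:R :> R by rewrite ler1n.
move: BB2 BA Q k1 b0; set q := quad_form _ _; set K : R := k%:R => BB2 BA Q k1 b0.
have Q1 : (2 * K + 1) * q <= 2 * K * b ^+ 2 by nra.
split=> //.
have b2 : b ^+ 2 <= ((2 * K + 1) * a) ^+ 2.
  by rewrite ler_sqr ?nnegrE ?mulr_ge0 //; lra.
have K0 : 0 < 2 * K + 1 by lra.
rewrite -(ler_pM2l K0); apply: le_trans Q1 _.
have -> : (2 * K + 1) * (2 * K * (2 * K + 1) * a ^+ 2) = 2 * K * ((2 * K + 1) * a) ^+ 2 by ring.
by rewrite ler_wpM2l //; lra.
Qed.

(** * Edges of a 3-graph as ordered triples, and the cubic form *)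

Lemma cards3_neq (T : finType) (u v w : T) :
  #|[set u; v; w]%SET| = 3 -> [/\ u != v, u != w & v != w].
Proof.
rewrite -finset.setUA !cardsU1 cards1 !inE negb_or.
by case: (u == v); case: (u == w); case: (v == w).
Qed.

Definition adj (G : hypergraph) (u v w : vert G) : bool :=
  ([set u; v; w])%SET \in edges G.

Definition cubic_form (R : realType) (G : hypergraph) (x : vert G -> R) : R :=
  \sum_u \sum_v \sum_w (adj u v w)%:R * (x u * x v * x w).

Section Adjacency.

Variable G : hypergraph.
Implicit Types u v w : vert G.

Lemma adj_swap12 u v w : adj u v w = adj v u w.
Proof. by rewrite /adj (finset.setUC [set u]%SET). Qed.

Lemma adj_swap23 u v w : adj u v w = adj u w v.
Proof. by rewrite /adj -!finset.setUA (finset.setUC [set v]%SET). Qed.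

Hypothesis G3 : uniform 3 G.

Lemma adj_neq u v w : adj u v w -> [/\ u != v, u != w & v != w].
Proof. by move=> /G3 /cards3_neq. Qed.

Lemma adjxx u w : adj u u w = false.
Proof. by apply/negP => /adj_neq[]; rewrite eqxx. Qed.

(** An edge has six orderings, counted by [inner]; after exchanging the sums, each ordered triple
    retains only the edge it spans. *)
Lemma lagrange_poly_cubic (R : realType) (x : vert G -> R) :
  6 * lagrange_poly x = cubic_form x.
Proof.
have inner (e : {set vert G}) : e \in edges G ->
  \sum_u \sum_v \sum_w ([set u; v; w]%SET == e)%:R * (x u * x v * x w) =
  6 * \prod_(i in e) x i.
  move=> /G3 e3.
  have E u v w : ([set u; v; w]%SET == e) =
      [&& u \in e, v \in (e :\ u)%SET & w \in (e :\ u :\ v)%SET].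
    apply/eqP/and3P => [ee|[ue ve we]].
      move: e3; rewrite -ee => /cards3_neq[uv uw vw].
      by rewrite !inE !eqxx !orbT (eq_sym v) uv (eq_sym w u) uw (eq_sym w) vw.
    apply/eqP; rewrite eqEcard e3; apply/andP; split.
      move: ue ve we; rewrite !inE => ue /andP[_ ve] /and3P[_ _ we].
      by rewrite !finset.subUset !finset.sub1set ue ve we.
    move: ve we; rewrite !inE => /andP[vu _] /and3P[wv wu _].
    by rewrite -finset.setUA !cardsU1 cards1 !inE !negb_or (eq_sym u v) (eq_sym u w) (eq_sym v w) vu wu wv.
  have P u v w : [set u; v; w]%SET == e -> x u * x v * x w = \prod_(i in e) x i.
    move=> ee; move: (ee); rewrite E !inE => /and3P[_ /andP[vu _] /and3P[wv wu _]].
    rewrite -(eqP ee) -finset.setUA big_setU1 /=; last by rewrite !inE negb_or eq_sym vu eq_sym.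
    by rewrite big_setU1 /= ?inE 1?eq_sym // big_set1 mulrA.
  transitivity (\sum_(u in e) \sum_(v in (e :\ u)%SET) \sum_(w in (e :\ u :\ v)%SET)
     \prod_(i in e) x i).
    rewrite [RHS]big_mkcond; apply: eq_bigr => u _.
    case: (boolP (u \in e)) => ue; last first.
      by do 2 (apply: big1 => ? _); rewrite E (negPf ue) mul0r.
    rewrite [RHS]big_mkcond; apply: eq_bigr => v _.
    case: (boolP (v \in (e :\ u)%SET)) => ve; last first.
      by apply: big1 => ? _; rewrite E (negPf ve) andbF mul0r.
    rewrite [RHS]big_mkcond; apply: eq_bigr => w _.
    case: (boolP (w \in (e :\ u :\ v)%SET)) => we; last first.
      by rewrite E (negPf we) !andbF mul0r.
    have ee : [set u; v; w]%SET == e by rewrite E ue ve we.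
    by rewrite ee mul1r P.
  set c := \prod_(i in e) x i.
  have S1 u v : u \in e -> v \in (e :\ u)%SET -> \sum_(w in (e :\ u :\ v)%SET) c = c.
    move=> ue ve; rewrite sumr_const; have := cardsD1 u e.
    have := cardsD1 v (e :\ u)%SET; rewrite ue ve e3 => E1 E2.
    by rewrite (_ : #|_| = 1%N) //; lia.
  have S2 u : u \in e -> \sum_(v in (e :\ u)%SET) \sum_(w in (e :\ u :\ v)%SET) c = c *+ 2.
    move=> ue; under eq_bigr => v ve do rewrite S1 //.
    rewrite sumr_const; have := cardsD1 u e; rewrite ue e3 => E1.
    by rewrite (_ : #|_| = 2%N) //; lia.
  under eq_bigr => u ue do rewrite S2 //.
  by rewrite sumr_const e3 -!mulrnA mulr_natl.
rewrite /lagrange_poly mulr_sumr -(eq_bigr _ inner) exchange_big.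
apply: eq_bigr => u _; rewrite exchange_big; apply: eq_bigr => v _.
rewrite exchange_big; apply: eq_bigr => w _; rewrite /adj.
have [ein|nein] := boolP (_ \in _).
  rewrite (bigD1 [set u; v; w]%SET) //= eqxx big1 ?addr0 // => e /andP[_ ne].
  by rewrite eq_sym (negPf ne) mul0r.
rewrite mul0r big1 // => e ein; rewrite (_ : (_ == _) = false) ?mul0r //.
by apply: contraNF nein => /eqP ->.
Qed.

End Adjacency.

Lemma cubic_form_scale (R : realType) (G : hypergraph) (c : R) (x : vert G -> R) :
  cubic_form (fun u => c * x u) = c ^+ 3 * cubic_form x.
Proof.
rewrite /cubic_form mulr_sumr; apply: eq_bigr => u _.
rewrite mulr_sumr; apply: eq_bigr => v _.
by rewrite mulr_sumr; apply: eq_bigr => w _; ring.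
Qed.

Lemma cubic_form_ge0 (R : realType) (G : hypergraph) (x : vert G -> R) :
  (forall u, 0 <= x u) -> 0 <= cubic_form x.
Proof.
by move=> x0; do 3 (apply: sumr_ge0 => ? _); rewrite !mulr_ge0.
Qed.

(* No edge repeats a vertex, so the cubic form is affine in each coordinate. *)
Lemma cubic_form_decr (R : realType) (G : hypergraph) (x : vert G -> R)
    (i : vert G) (eps : R) :
  uniform 3 G ->
  cubic_form (fun u => x u - eps * (u == i)%:R) =
    cubic_form x - 3 * eps * quad_form (adj i) x.
Proof.
move=> G3; pose d u : R := (u == i)%:R.
have dE (f : vert G -> R) : \sum_u d u * f u = f i.
  rewrite (bigD1 i) //= /d eqxx mul1r big1 ?addr0 // => u /negPf ->.
  by rewrite mul0r.
pose q (u v w : vert G) : R := (adj u v w)%:R.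
have q1 : \sum_u \sum_v \sum_w q u v w * (d u * x v * x w) = quad_form (adj i) x.
  rewrite -[RHS](dE (fun u => quad_form (adj u) x)); apply: eq_bigr => u _.
  rewrite /quad_form !mulr_sumr; apply: eq_bigr => v _.
  by rewrite !mulr_sumr; apply: eq_bigr => w _; rewrite /q; ring.
have q2 : \sum_u \sum_v \sum_w q u v w * (x u * d v * x w) = quad_form (adj i) x.
  rewrite exchange_big /= -[RHS]q1; apply: eq_bigr => u _; apply: eq_bigr => v _.
  by apply: eq_bigr => w _; rewrite /q adj_swap12; ring.
have q3 : \sum_u \sum_v \sum_w q u v w * (x u * x v * d w) = quad_form (adj i) x.
  rewrite -[RHS]q2; apply: eq_bigr => u _; rewrite exchange_big.
  apply: eq_bigr => v _; apply: eq_bigr => w _.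
  by rewrite /q adj_swap23; ring.
have E u v w : q u v w * ((x u - eps * d u) * (x v - eps * d v) * (x w - eps * d w)) =
   q u v w * (x u * x v * x w) - eps * (q u v w * (d u * x v * x w))
   - eps * (q u v w * (x u * d v * x w)) - eps * (q u v w * (x u * x v * d w)).
  rewrite /q; case: (boolP (adj u v w)) => [/(adj_neq G3)[uv uw vw]|_]; last by rewrite !mul0r; ring.
  have duv : d u * d v = 0.
    rewrite /d; case: (eqVneq u i) => [ui|_]; rewrite ?mul0r // -ui eq_sym (negPf uv).
    by rewrite mulr0.
  have duw : d u * d w = 0.
    rewrite /d; case: (eqVneq u i) => [ui|_]; rewrite ?mul0r // -ui eq_sym (negPf uw).
    by rewrite mulr0.
  have dvw : d v * d w = 0.
    rewrite /d; case: (eqVneq v i) => [vi|_]; rewrite ?mul0r // -vi eq_sym (negPf vw).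
    by rewrite mulr0.
  move: (d u) (d v) (d w) duv duw dvw => p r t pr pt rt.
  rewrite (_ : true%:R = 1 :> R) //.
  (* The terms in [eps ^+ 2] and [eps ^+ 3] contain products of two indicators, which vanish because
     the three vertices are distinct. *)
  transitivity (1 * (x u * x v * x w) - eps * (1 * (p * x v * x w))
    - eps * (1 * (x u * r * x w)) - eps * (1 * (x u * x v * t))
    + eps ^+ 2 * (p * r * x w + p * t * x v + r * t * x u) - eps ^+ 3 * (p * r * t)).
    by ring.
  by rewrite pr pt rt !mul0r !addr0 !mulr0 subr0 addr0.
rewrite /cubic_form.
under eq_bigr do under eq_bigr do under eq_bigr do rewrite -/(d _) -/(d _) -/(d _) E.
under eq_bigr do under eq_bigr do rewrite !sumrB -!mulr_sumr.
under eq_bigr do rewrite !sumrB -!mulr_sumr.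
by rewrite !sumrB -!mulr_sumr q1 q2 q3; ring.
Qed.

(** * Optimal weightings, links and stars *)

(** One half of the Lagrange multiplier condition: if the link of [i] were too light, taking weight
    off [i] and rescaling to the simplex would be a gain. *)
Lemma cubic_form_max_le_link (R : realType) (G : hypergraph) (x : vert G -> R)
    (i : vert G) :
  uniform 3 G -> simplex x ->
  (forall y : vert G -> R, simplex y -> cubic_form y <= cubic_form x) ->
  0 < x i -> cubic_form x <= quad_form (adj i) x.
Proof.
move=> G3 [x0 x1] xmax xi; rewrite leNgt; apply/negP => lt.
set F := cubic_form x in lt xmax; set D := quad_form _ _ in lt.
have F0 : 0 <= F by exact: cubic_form_ge0.
have D0 : 0 <= D by do 2 (apply: sumr_ge0 => ? _); rewrite !mulr_ge0.
have Fp : 0 < F by exact: le_lt_trans D0 lt.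
(* [(1 - eps) ^+ 3] comes from dividing the reduced weights by their sum [1 - eps], the form being
   homogeneous of degree three. *)
have bound eps : 0 < eps -> eps <= x i -> eps <= 1/2 ->
    F - 3 * eps * D <= (1 - eps) ^+ 3 * F.
  move=> e0 exi e2; rewrite /D -(cubic_form_decr x i eps G3).
  pose y u := x u - eps * (u == i)%:R.
  have ne : 1 - eps != 0 by rewrite gt_eqF //; lra.
  pose y' u := (1 - eps)^-1 * y u.
  have -> : cubic_form y = (1 - eps) ^+ 3 * cubic_form y'.
    rewrite cubic_form_scale mulrA -exprMn divff // expr1n mul1r //.
  rewrite ler_wpM2l ?exprn_ge0 //; first by lra.
  apply: xmax; split.
    move=> u; rewrite /y' mulr_ge0 ?invr_ge0; [|lra|] => //.
    rewrite /y; case: (eqVneq u i) => [->|_]; first by rewrite mulr1; lra.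
    by rewrite mulr0 subr0.
  rewrite /y' -mulr_sumr /y sumrB x1 -mulr_sumr (bigD1 i) //= eqxx big1 ?addr0 ?mulr1.
    by rewrite mulVf.
  by move=> u /negPf ->.
(* The three bounds keep the weight at [i] nonnegative, keep [1 - eps] positive, and let the linear
   gain [3 eps (F - D)] beat the quadratic loss [3 eps^2 F]. *)
pose eps := Num.min (x i) (Num.min (1/2) ((F - D) / (2 * F))).
have e0 : 0 < eps.
  rewrite /eps !lt_min xi /=; apply/andP; split; first by lra.
  by rewrite divr_gt0 ?mulr_gt0 ?subr_gt0.
have e1 : eps <= x i by rewrite /eps ge_min lexx.
have e2 : eps <= 1/2 by rewrite /eps !ge_min lexx orbT.
have e3 : eps <= (F - D) / (2 * F) by rewrite /eps !ge_min lexx !orbT.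
have {}e3 : eps * (2 * F) <= F - D.
  by rewrite -ler_pdivlMr // mulr_gt0.
have := bound eps e0 e1 e2.
have : 0 <= eps ^+ 3 * F by rewrite mulr_ge0 // exprn_ge0 // ltW.
move=> h1 h2.
have : eps * (3 * (F - D) - 3 * eps * F) <= 0 by nra.
rewrite pmulr_rle0 //; nra.
Qed.

Lemma star_subgraph (G : hypergraph) (t : nat) (i : vert G)
    (M : ('I_t * 'I_2)%type -> vert G) :
  uniform 3 G -> injective M ->
  (forall c, adj i (M (c, ord0)) (M (c, ord_max))) ->
  subgraph_of (linear_star 3 t) G.
Proof.
move=> G3 Minj Madj.
have ord2 (b : 'I_2) : b = ord0 \/ b = ord_max.
  by case: b => -[|[|//]] lt; [left|right]; apply: val_inj.
have Mi p : M p != i.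
  case: p => c b; have [+ + _] := adj_neq G3 (Madj c).
  by case: (ord2 b) => ->; rewrite ![i == _]eq_sym.
exists (fun o : vert (linear_star 3 t) => if o is Some p then M p else i); split.
  move=> [p|] [q|] //=.
  - by move/Minj ->.
  - by move/eqP; rewrite (negPf (Mi p)).
  - by move/esym/eqP; rewrite (negPf (Mi q)).
move=> _ /imsetP[c _ ->].
suff -> : ((fun o : vert (linear_star 3 t) => if o is Some p then M p else i)
    @: star_edge 3 c)%SET = [set i; M (c, ord0); M (c, ord_max)]%SET by exact: Madj.
apply/setP => u; rewrite !inE; apply/esym; apply/idP/imsetP.
  move=> /orP[/orP[]|] /eqP ->.
  - by exists None; rewrite // /star_edge !inE.
  - by exists (Some (c, ord0)); rewrite // /star_edge !inE /= eqxx.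
  - by exists (Some (c, ord_max)); rewrite // /star_edge !inE /= eqxx.
case=> -[[c' b]|]; rewrite /star_edge !inE /=; last first.
  by move=> _ ->; rewrite eqxx.
move=> /eqP -> ->.
by case: (ord2 b) => ->; rewrite eqxx ?orbT.
Qed.

(** Allows numbering vertices by an ['I_N] that is too large: surplus positions read the default
    [x0], where [h] vanishes. *)
Lemma sum_nth_pad (R : realType) (T : eqType) (x0 : T) (s : seq T) (N : nat) (h : T -> R) :
  (size s <= N)%N -> h x0 = 0 ->
  \sum_(a < N) h (nth x0 s a) = \sum_(u <- s) h u.
Proof.
move=> sN h0; rewrite -(big_mkord xpredT (fun a => h (nth x0 s a))).
rewrite (@big_cat_nat _ _ _ (size s)) //= [X in _ + X]big_nat [X in _ + X]big1 ?addr0.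
  by rewrite [RHS](big_nth x0).
by move=> a /andP[sa _]; rewrite nth_default.
Qed.

(** The vertices other than [i] are numbered by decreasing weight and [quad_form_no_matching] is
    applied to the link; [W] consists of [i] and the [2k + 1] heaviest other vertices, or all of
    them if there are fewer. *)
Lemma link_bound (R : realType) (G : hypergraph) (k : nat) (z : vert G -> R)
    (i : vert G) :
  (0 < k)%N -> uniform 3 G -> ~ subgraph_of (linear_star 3 k.+1) G ->
  (forall u, 0 <= z u <= z i) -> \sum_u z u = 2 * k%:R + 2 ->
  quad_form (adj i) z <= 2 * k%:R * (2 * k%:R + 1) - 1 \/
  exists W : {set vert G}, [/\ (#|W| <= 2 * k + 2)%N,
    z i <= \sum_(u in W) z u,
    quad_form (adj i) z <= 2 * k%:R * (2 * k%:R + 1) * z i ^+ 2 &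
    (2 * k%:R + 1) * quad_form (adj i) z <=
      2 * k%:R * (\sum_(u in W) z u - z i) ^+ 2].
Proof.
move=> k0 G3 noL z0i zsum.
have z0 u : 0 <= z u by case/andP: (z0i u).
have zi u : z u <= z i by case/andP: (z0i u).
pose leT u v := z v <= z u.
have leT_tr : transitive leT by move=> b a c ab bc; exact: le_trans bc ab.
have leT_tot : total leT by move=> a b; exact: le_total.
pose s := sort leT (enum [set~ i]%SET).
have s_mem u : (u \in s) = (u != i) by rewrite mem_sort mem_enum !inE.
have s_uniq : uniq s by rewrite sort_uniq enum_uniq.
have s_sorted : sorted leT s by exact: sort_sorted.
have sumE (h : vert G -> R) : h i = 0 -> \sum_(u <- s) h u = \sum_u h u.
  move=> h0; rewrite [RHS](bigD1 i) //= h0 add0r big_uniq //.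
  by apply: eq_bigl => u; rewrite s_mem.
(* Padding guarantees [2k + 2] positions; a padded position reads the default [i], which is isolated
   in its own link. *)
pose N := (size s + (2 * k + 2))%N.
pose p (a : 'I_N) := nth i s a.
have p_lt (a : 'I_N) : p a != i -> (a < size s)%N.
  by move=> pa; rewrite ltnNge; apply: contraNN pa => sa; rewrite /p nth_default.
(* Weight zero at [i] makes the padding contribute nothing. *)
pose z' u := if u == i then 0 else z u.
have z'i : z' i = 0 by rewrite /z' eqxx.
have z'0 u : 0 <= z' u by rewrite /z'; case: ifP.
pose y (a : 'I_N) := z' (p a).
pose e (a b : 'I_N) := adj i (p a) (p b).
have e_sym : symmetric e by move=> a b; rewrite /e adj_swap23.
have e_irr : irreflexive e.
  by move=> a; rewrite /e adj_swap12 adj_swap23 (adjxx G3).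
have e_nm : ~ has_matching k.+1 e.
  case=> M [Minj Me]; apply: noL.
  have ord2 (b : 'I_2) : b = ord0 \/ b = ord_max.
    by case: b => -[|[|//]] lt; [left|right]; apply: val_inj.
  have Mlt q : (M q < size s)%N.
    case: q => c b; apply: p_lt; have [+ + _] := adj_neq G3 (Me c).
    by case: (ord2 b) => ->; rewrite ![i == _]eq_sym.
  apply: (@star_subgraph G k.+1 i (fun q => p (M q))) => //.
  move=> q q' /eqP; rewrite nth_uniq // => /eqP /val_inj; exact: Minj.
have y_bd a : 0 <= y a <= z i by rewrite /y z'0 /= /z'; case: ifP.
have y_dec (u v : 'I_N) : (u <= v)%N -> y v <= y u.
  move=> uv; have [vs|sv] := ltnP v (size s); last first.
    by rewrite /y /p nth_default // z'i.
  have us := leq_ltn_trans uv vs.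
  have neq (a : nat) : (a < size s)%N -> nth i s a != i by move=> ?; rewrite -s_mem mem_nth.
  rewrite /y /z' /p !(negPf (neq _ _)) //.
  by apply: (sorted_leq_nth leT_tr _ i s_sorted) => // a; rewrite /leT.
have sN : (size s <= N)%N by rewrite leq_addr.
have y_sum : \sum_a y a = 2 * k%:R + 2 - z i.
  rewrite /y (sum_nth_pad sN z'i) sumE // -zsum (bigD1 i) //= z'i add0r.
  rewrite [in RHS](bigD1 i) //= addrC addrK.
  by apply: eq_bigr => u /negPf; rewrite /z' => ->.
have qE : quad_form e y = quad_form (adj i) z.
  have h0 : \sum_b (adj i i (p b))%:R * (z' i * y b) = 0.
    by rewrite big1 // => b _; rewrite (adjxx G3) mul0r.
  rewrite /quad_form (sum_nth_pad (h := fun u => \sum_b (adj i u (p b))%:R * (z' u * y b)) sN h0).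
  rewrite (sumE _ h0); apply: eq_bigr => u _.
  have h1 : (adj i u i)%:R * (z' u * z' i) = 0 by rewrite z'i !mulr0.
  rewrite (sum_nth_pad (h := fun v => (adj i u v)%:R * (z' u * z' v)) sN h1).
  rewrite (sumE _ h1); apply: eq_bigr => v _.
  case: (boolP (adj i u v)) => [/(adj_neq G3)[iu iv _]|_]; last by rewrite !mul0r.
  by rewrite /z' eq_sym (negPf iu) eq_sym (negPf iv).
have kN : (2 * k + 2 <= N)%N by rewrite leq_addl.
have := quad_form_no_matching k0 kN e_sym e_irr e_nm y_bd y_dec y_sum.
rewrite qE => -[H|[H1 H2]]; [by left|right].
pose s1 := take (2 * k + 1) s.
pose W := (i |: [set u in s1])%SET.
have is1 : i \notin [set u in s1]%SET.
  by rewrite inE; apply/negP => /mem_take; rewrite s_mem eqxx.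
have s1_uniq : uniq s1 by exact: take_uniq.
have WE : \sum_(u in W) z u - z i = \sum_(x : 'I_N | (x < 2 * k + 1)%N) y x.
  rewrite big_setU1 //= addrC addrK.
  have kN' : (2 * k + 1 <= N)%N by rewrite (leq_trans _ kN) // leq_add2l.
  rewrite -(big_ord_widen N (fun a => z' (nth i s a)) kN').
  have -> : \sum_(a < 2 * k + 1) z' (nth i s a) = \sum_(a < 2 * k + 1) z' (nth i s1 a).
    by apply: eq_bigr => a _; rewrite nth_take.
  rewrite (sum_nth_pad _ z'i); last by rewrite size_take_min geq_minl.
  rewrite [RHS]big_uniq //=; apply: eq_big => [u|u us]; first by rewrite inE.
  by rewrite /z' ifN //; apply: contraNneq is1 => <-.
exists W; split=> //; last by rewrite WE.
- rewrite cardsU1 is1 cardsE (card_uniqP s1_uniq) size_take_min.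
  by have := geq_minl (2 * k + 1) (size s); lia.
- by rewrite -subr_ge0 WE; apply: sumr_ge0 => a _; case/andP: (y_bd a).
Qed.

(** * Missing triples and spanning cliques *)

(** Counts ordered triples of distinct elements; the truncated predecessors keep the product zero
    when [W] has fewer than three. *)
Lemma sum_distinct_triples (R : realType) (T : finType) (W : {set T}) :
  \sum_u \sum_v \sum_w
    [&& u \in W, v \in (W :\ u)%SET & w \in (W :\ u :\ v)%SET]%:R =
  (#|W| * #|W|.-1 * #|W|.-2)%:R :> R.
Proof.
have cD (A : {set T}) x : x \in A -> #|(A :\ x)%SET| = #|A|.-1.
  by move=> xA; rewrite (cardsD1 x A) xA.
have sE (A : {set T}) (b : bool) (c : nat) :
    \sum_x (b && (x \in A))%:R * c%:R = (b * #|A| * c)%:R :> R.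
  rewrite -mulr_suml natrM; congr (_ * _); case: b => /=; last by rewrite mul0n big1.
  by rewrite mul1n -sumr_const [RHS]big_mkcond; apply: eq_bigr => x _; case: (x \in A).
transitivity (\sum_u (true && (u \in W))%:R * (#|W|.-1 * #|W|.-2)%:R : R); last first.
  by rewrite sE mul1n mulnA.
apply: eq_bigr => u _.
transitivity (\sum_v ((u \in W) && (v \in (W :\ u)%SET))%:R * #|W|.-2%:R : R); last first.
  rewrite sE /= -natrM; congr _%:R; case: (boolP (u \in W)) => [uW|_]; last by rewrite !mul0n.
  by rewrite cD // mulnA.
apply: eq_bigr => v _.
transitivity (\sum_w (((u \in W) && (v \in (W :\ u)%SET)) && (w \in (W :\ u :\ v)%SET))%:R * 1%:R : R).
  by apply: eq_bigr => w _; rewrite mulr1 andbA.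
rewrite sE muln1 -natrM; congr _%:R.
case: (boolP (u \in W)) => [uW|_]; last by rewrite !mul0n.
case: (boolP (v \in _)) => [vW|_]; last by rewrite !mul0n.
by rewrite cD // cD.
Qed.

Lemma in_distinct_triple (T : finType) (W : {set T}) (u v w : T) :
  [&& u \in W, v \in (W :\ u)%SET & w \in (W :\ u :\ v)%SET] =
  [&& [&& u \in W, v \in W & w \in W], u != v, u != w & v != w].
Proof.
rewrite !inE (eq_sym v u) (eq_sym w u) (eq_sym w v).
by case: (u \in W); case: (v \in W); case: (w \in W); case: (u == v);
   case: (u == w); case: (v == w).
Qed.

(** A triple inside [W] weighs at most [a ^+ 3], and [(p, q, s)] is absent; only this one of its six
    orderings is discounted. A triple leaving [W] is charged to an outside vertex in one of three
    positions. *)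
Lemma cubic_form_missing_triple (R : realType) (G : hypergraph) (z : vert G -> R)
    (W : {set vert G}) (a : R) (p q s : vert G) :
  uniform 3 G -> (forall u, 0 <= z u <= a) ->
  [/\ p \in W, q \in W & s \in W] -> [/\ p != q, p != s & q != s] ->
  ~~ adj p q s ->
  cubic_form z <= a ^+ 3 * ((#|W| * #|W|.-1 * #|W|.-2)%:R - 1) +
    3 * (\sum_u z u - \sum_(u in W) z u) * (\sum_u z u) ^+ 2.
Proof.
move=> G3 z0a [pW qW sW] [pq ps qs] npqs.
have z0 u : 0 <= z u by case/andP: (z0a u).
have za u : z u <= a by case/andP: (z0a u).
pose d (x u : vert G) : R := (u == x)%:R.
pose o u : R := (u \notin W)%:R * z u.
pose ind u v w : R := [&& u \in W, v \in (W :\ u)%SET & w \in (W :\ u :\ v)%SET]%:R.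
have pt u v w : (adj u v w)%:R * (z u * z v * z w) <=
    a ^+ 3 * ind u v w - a ^+ 3 * (d p u * (d q v * d s w)) +
    (o u * (z v * z w) + z u * (o v * z w) + z u * (z v * o w)).
  have zz : 0 <= z u * z v * z w by rewrite !mulr_ge0.
  have a0 : 0 <= a by exact: le_trans (z0 u) (za u).
  have a3 : 0 <= a ^+ 3 by exact: exprn_ge0.
  have zz3 : z u * z v * z w <= a ^+ 3.
    by rewrite exprSr expr2 !ler_pM // mulr_ge0.
  have o0 x : 0 <= o x by rewrite mulr_ge0.
  have r0 : 0 <= o u * (z v * z w) + z u * (o v * z w) + z u * (z v * o w).
    by rewrite !addr_ge0 // !mulr_ge0.
  have i0 : 0 <= a ^+ 3 * ind u v w - a ^+ 3 * (d p u * (d q v * d s w)).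
    rewrite -mulrBr mulr_ge0 // /d.
    case: (eqVneq u p) => [->|_]; last by rewrite mul0r subr0.
    case: (eqVneq v q) => [->|_]; last by rewrite mul0r mulr0 subr0.
    case: (eqVneq w s) => [->|_]; last by rewrite !mulr0 subr0.
    by rewrite /ind in_distinct_triple pW qW sW pq ps qs !mulr1 subrr.
  case: (boolP (adj u v w)) => [auv|_]; last by rewrite mul0r addr_ge0.
  have [uv uw vw] := adj_neq G3 auv.
  case: (boolP [&& u \in W, v \in W & w \in W]) => [inW|].
    rewrite /ind in_distinct_triple inW uv uw vw /= mulr1.
    have -> : d p u * (d q v * d s w) = 0.
      rewrite /d; case: (eqVneq u p) => [E1|_]; last by rewrite mul0r.
      case: (eqVneq v q) => [E2|_]; last by rewrite mul0r mulr0.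
      case: (eqVneq w s) => [E3|_]; last by rewrite !mulr0.
      by move: npqs; rewrite -E1 -E2 -E3 auv.
    by rewrite mul1r mulr0 subr0 (le_trans zz3) // lerDl.
  move=> nW; rewrite -[leLHS]add0r lerD // mul1r.
  have o1 x : x \notin W -> o x = z x by rewrite /o => ->; rewrite mul1r.
  have [g1 [g2 g3]] : 0 <= o u * (z v * z w) /\ 0 <= z u * (o v * z w) /\ 0 <= z u * (z v * o w).
    by rewrite !mulr_ge0.
  move: nW; rewrite !negb_and => /or3P[] /o1 E; rewrite E in g1 g2 g3 *; lra.
have E3 (f g h : vert G -> R) : \sum_u \sum_v \sum_w f u * (g v * h w) =
    (\sum_u f u) * ((\sum_v g v) * (\sum_w h w)).
  rewrite mulr_suml; apply: eq_bigr => u _; rewrite mulr_suml mulr_sumr.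
  by apply: eq_bigr => v _; rewrite !mulr_sumr.
have sd x : \sum_u d x u = 1.
  by rewrite (bigD1 x) //= /d eqxx big1 ?addr0 // => u /negPf ->.
have so : \sum_u o u = \sum_u z u - \sum_(u in W) z u.
  rewrite [X in X - _](bigID (mem W)) /= addrAC subrr add0r /o [RHS]big_mkcond /=.
  by apply: eq_bigr => u _; case: (u \in W); rewrite ?mul1r ?mul0r.
apply: le_trans (_ : \sum_u \sum_v \sum_w (a ^+ 3 * ind u v w - a ^+ 3 * (d p u * (d q v * d s w)) +
    (o u * (z v * z w) + z u * (o v * z w) + z u * (z v * o w))) <= _).
  by do 3 (apply: ler_sum => ? _); exact: pt.
have lin1 (c : R) (f1 f2 f3 f4 f5 : vert G -> R) :
  \sum_w (c * f1 w - c * f2 w + (f3 w + f4 w + f5 w)) =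
  c * (\sum_w f1 w) - c * (\sum_w f2 w) + (\sum_w f3 w + \sum_w f4 w + \sum_w f5 w).
  by rewrite !mulr_sumr !big_split /= sumrN.
have lin (c : R) (f1 f2 f3 f4 f5 : vert G -> vert G -> vert G -> R) :
  \sum_u \sum_v \sum_w (c * f1 u v w - c * f2 u v w + (f3 u v w + f4 u v w + f5 u v w)) =
  c * (\sum_u \sum_v \sum_w f1 u v w) - c * (\sum_u \sum_v \sum_w f2 u v w) +
  (\sum_u \sum_v \sum_w f3 u v w + \sum_u \sum_v \sum_w f4 u v w + \sum_u \sum_v \sum_w f5 u v w).
  rewrite -lin1; apply: eq_bigr => u _; rewrite -lin1; apply: eq_bigr => v _.
  by rewrite -lin1.
rewrite (lin _ ind (fun u v w => d p u * (d q v * d s w)) (fun u v w => o u * (z v * z w))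
  (fun u v w => z u * (o v * z w)) (fun u v w => z u * (z v * o w))).
rewrite !E3 !sd so sum_distinct_triples le_eqVlt; apply/orP; left; apply/eqP.
by ring.
Qed.

Lemma double_add_inj (c c' b b' : nat) :
  (b < 2)%N -> (b' < 2)%N -> (2 * c + b = 2 * c' + b')%N -> c = c' /\ b = b'.
Proof. by move=> *; lia. Qed.

Lemma double_add_lt (t c b : nat) : (c < t)%N -> (b < 2)%N -> (2 * c + b < 2 * t)%N.
Proof. by move=> *; lia. Qed.

Lemma cards3_exists (T : finType) (e : {set T}) : #|e| = 3 ->
  exists u v w, [/\ e = [set u; v; w]%SET, u != v, u != w & v != w].
Proof.
move=> e3; have eE := set_enum e; move: (e3); rewrite cardE.
case: (enum e) eE => [|u [|v [|w [|]]]] //= eE _.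
have {}eE : e = [set u; v; w]%SET by rewrite -eE; apply/setP => x; rewrite !inE orbA.
by exists u, v, w; move: e3; rewrite eE => /cards3_neq[].
Qed.

(* An outside vertex [u] shares an edge with some [w] in [W]; that edge together
   with a matching of the clique [W] forms a star centred at [w]. *)
Lemma clique_spans (G : hypergraph) (t : nat) (W : {set vert G}) :
  (0 < t)%N -> uniform 3 G -> ~ subgraph_of (linear_star 3 t) G ->
  covers_pairs G -> (2 * t <= #|W|)%N ->
  (forall p q s, [/\ p \in W, q \in W & s \in W] ->
     [/\ p != q, p != s & q != s] -> adj p q s) ->
  forall u, u \in W.
Proof.
move=> t0 G3 noL cov Wt Wadj u; apply/negPn/negP => uW; apply: noL.
have [w wW] : exists w, w \in W by apply/card_gt0P; lia.
have uw : u != w by apply: contraNneq uW => ->.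
have [e [eG ue we]] := cov u w uw.
have e3 := G3 e eG.
have [y yE] : exists y, (e :\ u :\ w)%SET = [set y]%SET.
  apply/cards1P; have := cardsD1 u e; have := cardsD1 w (e :\ u)%SET.
  by rewrite !inE we ue e3 eq_sym uw /=; lia.
have [yw yu ye] : [/\ y != w, y != u & y \in e].
  have : y \in (e :\ u :\ w)%SET by rewrite yE inE.
  by rewrite !inE => /and3P[].
have wuy : adj w u y.
  rewrite /adj (_ : [set w; u; y]%SET = e) //; apply/eqP; rewrite eqEcard e3.
  rewrite !finset.subUset !finset.sub1set ue we ye /= -finset.setUA !cardsU1 cards1 !inE.
  by rewrite negb_or (eq_sym w u) uw (eq_sym w y) yw (eq_sym u y) yu.
pose l := enum (W :\ w :\ y)%SET.
have l_mem v : (v \in l) = [&& v != y, v != w & v \in W] by rewrite mem_enum !inE.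
(* [y] may lie inside or outside [W]: at most [w] and [y] are removed from [W], and [u] and [y] are
   added, so at least [2t] vertices remain. *)
pose L := [:: u, y & l].
have L_uniq : uniq L.
  have uL : u \notin y :: l by rewrite inE l_mem (negPf uW) !andbF orbF eq_sym.
  by rewrite /L !cons_uniq uL l_mem eqxx enum_uniq.
have L_size : (2 * t <= size L)%N.
  rewrite /= -cardE; have := cardsD1 w W; have := cardsD1 y (W :\ w)%SET.
  by rewrite wW; case: (y \in _) => /=; lia.
(* Edge [c] takes positions [2c] and [2c + 1], so edge zero is the pair [u], [y] and all others lie
   in the clique. *)
pose M (p : 'I_t * 'I_2) := nth u L (2 * p.1 + p.2).
have idx (p : 'I_t * 'I_2) : (2 * p.1 + p.2 < size L)%N.
  by apply: leq_trans L_size; exact: double_add_lt.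
apply: (@star_subgraph G t w M) => //.
  move=> p q /eqP; rewrite nth_uniq // => /eqP E.
  case: p q E => [c b] [c' b'] /= /(double_add_inj (ltn_ord b) (ltn_ord b'))[E E'].
  by congr pair; exact: val_inj.
move=> c; have [c0|c0] := posnP c.
  by rewrite /M /= c0.
have inl (b : 'I_2) : M (c, b) \in l.
  have E : (2 * c + b = (2 * c.-1 + b).+2)%N by rewrite -{1}(prednK c0) mulnS.
  by have := idx (c, b); rewrite /M /= E /= => lt; exact: mem_nth.
have := inl ord0; have := inl ord_max; rewrite !l_mem => /and3P[_ m1 m2] /and3P[_ m3 m4].
apply: Wadj; split=> //; rewrite 1?eq_sym //.
by rewrite nth_uniq // eqn_add2l.
Qed.

Lemma isomorphic_complete (G : hypergraph) (n : nat) :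
  uniform 3 G -> #|vert G| = n ->
  (forall p q s : vert G, [/\ p != q, p != s & q != s] -> adj p q s) ->
  isomorphic G (complete 3 n).
Proof.
move=> G3 cV Gadj; exists (fun v => cast_ord cV (enum_rank v)); split.
  exists (fun a => enum_val (cast_ord (esym cV) a)) => v.
    by rewrite cast_ordK enum_rankK.
  by rewrite enum_valK cast_ordKV.
move=> e; rewrite inE card_imset; last first.
  by move=> u v /cast_ord_inj /enum_rank_inj.
apply/eqP/idP => [|/G3 //] e3.
have [u [v [w [-> uv uw vw]]]] := cards3_exists e3.
exact: Gadj.
Qed.

(** The star has [2t + 1] vertices. *)
Lemma complete_no_star (t : nat) :
  ~ subgraph_of (linear_star 3 t) (complete 3 (2 * t)).
Proof.
case=> f [f_inj _]; have := leq_card f f_inj.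
by rewrite /= card_option card_prod !card_ord /=; lia.
Qed.

(** * The sharp upper bound *)

Lemma lagrangian_no_vertex (R : realType) (G : hypergraph) :
  (vert G -> False) -> lagrangian R G = 0.
Proof.
move=> nov; rewrite /lagrangian (_ : image _ _ = set0) ?sup0 //.
rewrite -subset0 => _ [x [_ x1] _] /=.
by move: x1; rewrite big1 => [/esym/eqP|u]; [rewrite oner_eq0|case: (nov u)].
Qed.

Lemma quad_form_scale (R : realType) (T : finType) (e : rel T) (c : R) (x : T -> R) :
  quad_form e (fun u => c * x u) = c ^+ 2 * quad_form e x.
Proof.
rewrite /quad_form mulr_sumr; apply: eq_bigr => u _.
by rewrite mulr_sumr; apply: eq_bigr => v _; ring.
Qed.

(** Scaling by [2t], with [t = k + 1], turns the uniform weighting of [2t] vertices into the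
    constant one. The coefficients are six times the square and the cube of [2t], the six coming
    from the orderings of an edge. *)
Lemma lagrangian_link (R : realType) (G : hypergraph) (k : nat) (v0 : vert G) :
  uniform 3 G ->
  exists (z : vert G -> R) (i : vert G), [/\ forall u, 0 <= z u <= z i,
    \sum_u z u = 2 * k%:R + 2,
    24 * (k%:R + 1) ^+ 2 * lagrangian R G <= quad_form (adj i) z &
    cubic_form z = 48 * (k%:R + 1) ^+ 3 * lagrangian R G].
Proof.
move=> G3; have [x [xS xL xmax]] := lagrangian_attained R v0.
have [x0 x1] := xS.
have [i _ imax] := @arg_maxP _ R _ v0 predT x isT.
have xi : 0 < x i.
  rewrite lt_neqAle x0 andbT; apply/eqP => xi0.
  have : \sum_u x u = 0.
    by apply: big1 => u _; apply/eqP; rewrite eq_le x0 andbT xi0; exact: imax.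
  by move/eqP; rewrite x1 oner_eq0.
have FL : cubic_form x = 6 * lagrangian R G by rewrite -lagrange_poly_cubic // xL.
have := cubic_form_max_le_link G3 xS _ xi.
have xmax' (y : vert G -> R) : simplex y -> cubic_form y <= cubic_form x.
  by move=> yS; rewrite -!lagrange_poly_cubic // ler_pM2l //; exact: xmax.
move=> /(_ xmax') link.
pose c : R := 2 * k%:R + 2.
have k0 : 0 <= k%:R :> R by [].
have c0 : 0 < c by rewrite /c; lra.
exists (fun u => c * x u), i; split.
- move=> u; apply/andP; split; first by rewrite mulr_ge0 // ltW.
  by rewrite ler_pM2l //; exact: imax.
- by rewrite -mulr_sumr x1 mulr1.
- rewrite quad_form_scale.
  have -> : 24 * (k%:R + 1) ^+ 2 * lagrangian R G = c ^+ 2 * cubic_form x.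
    by rewrite FL /c; ring.
  by rewrite ler_pM2l // exprn_gt0.
- by rewrite cubic_form_scale FL /c; ring.
Qed.

(** The two bounds of [link_bound] complement each other: the cap settles [z i <= 1], and for
    [z i >= 1] the rest of [W] weighs at most [2k + 1]. *)
Lemma lagrangian_star_free_le (R : realType) (G : hypergraph) (k : nat) :
  (0 < k)%N -> uniform 3 G -> ~ subgraph_of (linear_star 3 k.+1) G ->
  24 * (k%:R + 1) ^+ 2 * lagrangian R G <= 2 * k%:R * (2 * k%:R + 1).
Proof.
move=> k0 G3 noL.
have k1 : 1 <= k%:R :> R by rewrite ler1n.
case: (pickP (@predT (vert G))) => [v0 _|nov]; last first.
  rewrite lagrangian_no_vertex => [|v]; last by have := nov v.
  by rewrite mulr0 !mulr_ge0 //; lra.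
have [z [i [z0i zsum link _]]] := lagrangian_link R k v0 G3.
apply: le_trans link _.
have [|[W [_ iW H1 H2]]] := link_bound k0 G3 noL z0i zsum; first by lra.
have z0 u : 0 <= z u by case/andP: (z0i u).
have [a1|/ltW a1] := leP (z i) 1.
  apply: le_trans H1 _; rewrite ler_piMr ?expr_le1 //.
  by rewrite !mulr_ge0 //; lra.
have WT : \sum_(u in W) z u <= 2 * k%:R + 2.
  by rewrite -zsum [leRHS](bigID (mem W)) /= lerDl sumr_ge0.
have K0 : 0 < 2 * k%:R + 1 :> R by lra.
rewrite -(ler_pM2l K0); apply: le_trans H2 _.
rewrite [leRHS](_ : _ = 2 * k%:R * (2 * k%:R + 1) ^+ 2); last by ring.
by rewrite ler_wpM2l ?ler_sqr ?nnegrE //; lra.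
Qed.

(* Any small enough multiple of [t ^- 4], with [t = k + 1], would do. *)
Definition stability_gap (R : realType) (k : nat) : R := (1000 * (k%:R + 1) ^+ 4)^-1.

Lemma stability_gap_gt0 (R : realType) (k : nat) : 0 < stability_gap R k.
Proof. by rewrite invr_gt0 mulr_gt0 // exprn_gt0 // -[1]/(1%:R) -natrD ltr0n addn1. Qed.

Lemma stability_gap_small (R : realType) (K eta : R) :
  1 <= K -> 0 < eta -> eta * (K + 1) ^+ 4 = 1 / 1000 ->
  [/\ eta <= 1 / 1000, eta * (K + 1) <= 1 / 1000,
      eta * (K + 1) ^+ 2 <= 1 / 1000 & eta * (K + 1) ^+ 3 <= 1 / 1000].
Proof.
move=> K1 eta0 <-; have K2 : 1 < K + 1 by lra.
split.
- by rewrite -[leLHS]mulr1 ler_pM2l // exprn_ege1 // ltW.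
- by rewrite ler_pM2l // ler_eXnr // ltW.
- by rewrite ler_pM2l // ler_eXn2l.
- by rewrite ler_pM2l // ler_eXn2l.
Qed.

(** * Nearly extremal weightings and the stability gap *)

(** With [M = 2K(2K + 1)] one has [M (1 - eta)^2 <= M - eta < Q], so a smaller [a] or [B] would
    contradict one of the two upper bounds on [Q]. *)
Lemma near_extremal_weights (R : realType) (K eta a B Q : R) :
  1 <= K -> 0 < eta -> eta <= 1 / 1000 -> 0 <= a -> 0 <= B ->
  2 * K * (2 * K + 1) - eta < Q -> Q <= 2 * K * (2 * K + 1) * a ^+ 2 ->
  (2 * K + 1) * Q <= 2 * K * B ^+ 2 ->
  1 - eta <= a /\ (2 * K + 1) * (1 - eta) <= B.
Proof.
move=> K1 eta0 eta1 a0 B0 bigQ H1 H2.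
have M1 : 6 <= 2 * K * (2 * K + 1) by nra.
have gap : 2 * K * (2 * K + 1) * (1 - eta) ^+ 2 < Q.
  apply: le_lt_trans bigQ; move: {H1 H2} (2 * K * (2 * K + 1)) M1 => M M1.
  have : 0 <= eta * (M * (2 - eta) - 1) by rewrite mulr_ge0 ?ltW //; nra.
  by lra.
have M0 : 0 < 2 * K * (2 * K + 1) by lra.
have e0 : 0 <= 1 - eta by lra.
split; rewrite leNgt; apply/negP => lt.
  have : a ^+ 2 <= (1 - eta) ^+ 2 by rewrite ler_sqr ?nnegrE // ltW.
  rewrite -(ler_pM2l M0) => /(le_trans H1) /(lt_le_trans gap).
  by rewrite ltxx.
have c0 : 0 <= (2 * K + 1) * (1 - eta) by rewrite mulr_ge0 //; lra.
have : B ^+ 2 <= ((2 * K + 1) * (1 - eta)) ^+ 2 by rewrite ler_sqr ?nnegrE // ltW.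
have K0 : 0 < 2 * K by lra.
rewrite -(ler_pM2l K0) => /(le_trans H2).
rewrite [leRHS](_ : _ = (2 * K + 1) * (2 * K * (2 * K + 1) * (1 - eta) ^+ 2)); last by ring.
by rewrite ler_pM2l; [rewrite leNgt gap|lra].
Qed.

(** Rules out [#|W| <= 2k + 1], for then the weight of [W] beyond [a] would be at most
    [2 * K * a]. *)
Lemma near_extremal_many_vertices (R : realType) (K eta a B : R) :
  1 <= K -> 0 < eta -> eta * (K + 1) ^+ 2 <= 1 / 1000 ->
  (2 * K + 1) * (1 - eta) <= B -> a <= 1 + (2 * K + 1) * eta ->
  2 * K * a < B.
Proof.
move=> K1 eta0 e2 BE aE; apply: lt_le_trans BE.
have : 2 * K * a <= 2 * K * (1 + (2 * K + 1) * eta) by rewrite ler_pM2l //; lra.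
by nra.
Qed.

(** The missing triple saves a unit, which outweighs the errors: at most [128/1000] from [a]
    exceeding one, [24/1000] from the weight outside [W] and [2/1000] from the gap. The fourth power
    of [K + 1] absorbs the product of [dl] and [N]. *)
Lemma missing_triple_numerics (R : realType) (K eta a n r : R) :
  1 <= K -> 0 < eta -> eta * (K + 1) ^+ 4 = 1 / 1000 ->
  0 <= a -> a <= 1 + (2 * K + 1) * eta ->
  n <= (2 * K + 2) * (2 * K + 1) * (2 * K) -> r <= 2 * (K + 1) * eta ->
  a ^+ 3 * (n - 1) + 3 * r * (2 * K + 2) ^+ 2 <
    2 * (K + 1) * (2 * K * (2 * K + 1) - eta).
Proof.
move=> K1 eta0 e4 a0 aE nle rle.
have [e0 e1 e2 e3] := stability_gap_small K1 eta0 e4.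
pose dl := 4 * (K + 1) * eta.
have dl0 : 0 <= dl by rewrite /dl !mulr_ge0 ?ltW //; clear - K1; lra.
have dl1 : dl <= 1 / 100 by rewrite /dl; clear - e1; lra.
have a3 : a ^+ 3 <= 1 + 4 * dl.
  have Ke : 0 <= K * eta by rewrite mulr_ge0 ?ltW //; clear - K1; lra.
  have adl : a <= 1 + dl by rewrite /dl; clear - aE Ke eta0; lra.
  apply: (@le_trans _ _ ((1 + dl) ^+ 3)).
    by rewrite lerXn2r ?nnegrE //; lra.
  by move: dl {adl} dl0 dl1 => d d0 d1; nra.
set N := (2 * K + 2) * (2 * K + 1) * (2 * K) in nle.
have N8 : N <= 8 * (K + 1) ^+ 3 by rewrite /N; clear - K1; nra.
have N1 : 1 <= N.
  by rewrite /N; clear - K1; nra.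
have m1 : a ^+ 3 * (n - 1) <= (1 + 4 * dl) * (N - 1).
  apply: (@le_trans _ _ (a ^+ 3 * (N - 1))).
    by rewrite ler_wpM2l ?exprn_ge0 // lerD2r.
  by rewrite ler_wpM2r // subr_ge0.
have m2 : dl * (N - 1) <= 32 / 1000.
  apply: (@le_trans _ _ (dl * (8 * (K + 1) ^+ 3))).
    by rewrite ler_wpM2l // lerBlDr (le_trans N8) // lerDl.
  rewrite /dl (_ : _ * _ = 32 * (eta * (K + 1) ^+ 4)); last by ring.
  by rewrite e4; clear; lra.
have m3 : 3 * r * (2 * K + 2) ^+ 2 <= 24 / 1000.
  apply: (@le_trans _ _ (3 * (2 * (K + 1) * eta) * (2 * K + 2) ^+ 2)).
    by rewrite ler_wpM2r ?sqr_ge0 // ler_pM2l.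
  rewrite (_ : _ * _ = 24 * (eta * (K + 1) ^+ 3)); last by ring.
  by clear - e3; lra.
rewrite [ltRHS](_ : _ = N - 2 * (eta * (K + 1))); last by rewrite /N; ring.
by clear - m1 m2 m3 e1; lra.
Qed.

Lemma lagrangian_star_free_gap (R : realType) (G : hypergraph) (k : nat) :
  (0 < k)%N -> uniform 3 G -> ~ subgraph_of (linear_star 3 k.+1) G ->
  covers_pairs G -> ~ isomorphic G (complete 3 (2 * k.+1)) ->
  24 * (k%:R + 1) ^+ 2 * lagrangian R G <=
    2 * k%:R * (2 * k%:R + 1) - stability_gap R k.
Proof.
move=> k0 G3 noL cov noI.
have k1 : 1 <= k%:R :> R by rewrite ler1n.
have eta0 := stability_gap_gt0 R k; set eta := stability_gap R k in eta0 *.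
have e4 : eta * (k%:R + 1) ^+ 4 = 1 / 1000.
  by rewrite /eta /stability_gap; field; rewrite gt_eqF //; lra.
have [e0 e1 e2 e3] := stability_gap_small k1 eta0 e4.
case: (pickP (@predT (vert G))) => [v0 _|nov]; last first.
  rewrite lagrangian_no_vertex => [|v]; last by have := nov v.
  by rewrite mulr0; clear - k1 e0; nra.
have [z [i [z0i zsum link cub]]] := lagrangian_link R k v0 G3.
have z0 u : 0 <= z u by case/andP: (z0i u).
have za u : z u <= z i by case/andP: (z0i u).
have [|[W [Wc iW H1 H2]]] := link_bound k0 G3 noL z0i zsum.
  by move/(le_trans link)/le_trans; apply; clear - e0; lra.
rewrite leNgt; apply/negP => big.
rewrite -subr_ge0 in iW.
have [a_ge B_ge] :=
  near_extremal_weights k1 eta0 e0 (z0 i) iW (lt_le_trans big link) H1 H2.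
have WT : \sum_(u in W) z u <= 2 * k%:R + 2.
  by rewrite -zsum [leRHS](bigID (mem W)) /= lerDl sumr_ge0.
(* [W] weighs at most [2k + 2], and its part beyond [z i] is already nearly [2k + 1]. *)
have a_le : z i <= 1 + (2 * k%:R + 1) * eta by clear - WT B_ge; lra.
have r_le : 2 * k%:R + 2 - \sum_(u in W) z u <= 2 * (k%:R + 1) * eta.
  by clear - a_ge B_ge; lra.
have Wc' : (2 * k.+1 <= #|W|)%N.
  rewrite leqNgt; apply/negP => Wlt.
  have Wle : (#|W| <= 2 * k + 1)%N by clear - Wlt; lia.
  have := near_extremal_many_vertices k1 eta0 e2 B_ge a_le.
  have := sum_le_card (z0 i) za Wle; rewrite natrD natrM; clear; lra.
case: (pselect (forall p q s, [/\ p \in W, q \in W & s \in W] ->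
     [/\ p != q, p != s & q != s] -> adj p q s)) => [Wadj|].
  (* A clique [W] is the whole vertex set and has exactly [2k + 2] elements, against [noI]. *)
  have all_W := clique_spans (ltn0Sn k) G3 noL cov Wc' Wadj.
  apply: noI; apply: isomorphic_complete => // [|p q s]; last exact: Wadj.
  have WV : #|W| = #|vert G| by apply: eq_card => u; rewrite all_W.
  by rewrite -WV; clear - Wc Wc'; lia.
move=> /existsNP[p /existsNP[q /existsNP[s /not_implyP[inW /not_implyP[neq /negP npqs]]]]].
have nle : (#|W| * #|W|.-1 * #|W|.-2)%:R <=
    (2 * k%:R + 2) * (2 * k%:R + 1) * (2 * k%:R) :> R.
  rewrite [leRHS](_ : _ = ((2 * k + 2) * (2 * k + 1) * (2 * k))%:R); last first.
    by rewrite !(natrM, natrD).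
  by rewrite ler_nat !leq_mul //; clear - Wc; lia.
have := cubic_form_missing_triple G3 z0i inW neq npqs; rewrite cub zsum.
move/le_lt_trans/(_ (missing_triple_numerics k1 eta0 e4 (z0 i) a_le nle r_le)).
(* The cubic form is [2t] times the quantity that [big] bounds from below. *)
rewrite [ltLHS](_ : _ = 2 * (k%:R + 1) * (24 * (k%:R + 1) ^+ 2 * lagrangian R G)); last by ring.
rewrite ltr_pM2l; last by clear - k1; lra.
by move=> /lt_trans/(_ big); rewrite ltxx.
Qed.

(** * The complete 3-graph and the conclusion *)

(** The uniform weighting is the witness. *)
Lemma lagrangian_complete_ge (R : realType) (k : nat) :
  2 * k%:R * (2 * k%:R + 1) <=
  24 * (k%:R + 1) ^+ 2 * lagrangian R (complete 3 (2 * k.+1)).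
Proof.
set G := complete _ _; have G3 : uniform 3 G := @complete_uniform 3 _.
have n0 : (0 < 2 * k.+1)%N by [].
have [x [_ xL xmax]] := lagrangian_attained R (G := G) (Ordinal n0).
have k0 : 0 <= k%:R :> R by [].
pose c : R := (2 * k%:R + 2)^-1.
have cn0 : 2 * k%:R + 2 != 0 :> R by rewrite gt_eqF //; lra.
have c0 : 0 < c by rewrite invr_gt0; lra.
have nE : #|[set: 'I_(2 * k.+1)]%SET| = (2 * k + 2)%N.
  by rewrite cardsT card_ord mulnS addnC.
have cS : simplex (fun _ : vert G => c).
  split=> [_|]; first exact: ltW.
  rewrite sumr_const -mulr_natl card_ord mulnS natrD natrM addrC; exact: divff.
have : 6 * lagrange_poly (fun _ : vert G => c) <= 6 * lagrangian R G.
  by rewrite ler_pM2l // -xL; exact: xmax.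
rewrite (lagrange_poly_cubic G3).
have -> : cubic_form (fun _ : vert G => c) =
    c ^+ 3 * ((2 * k%:R + 2) * (2 * k%:R + 1) * (2 * k%:R)).
  transitivity (c ^+ 3 * (#|[set: 'I_(2 * k.+1)]%SET| * #|[set: 'I_(2 * k.+1)]%SET|.-1 *
      #|[set: 'I_(2 * k.+1)]%SET|.-2)%:R).
    rewrite -sum_distinct_triples /cubic_form mulr_sumr; apply: eq_bigr => u _.
    rewrite mulr_sumr; apply: eq_bigr => v _; rewrite mulr_sumr; apply: eq_bigr => w _.
    rewrite mulrC (_ : c * c * c = c ^+ 3); last by ring.
    congr (_ * (nat_of_bool _)%:R); rewrite in_distinct_triple !inE /=.
    apply/idP/and3P => [/(adj_neq G3) //|[uv uw vw]].
    rewrite /adj inE -finset.setUA !cardsU1 cards1 !inE negb_or.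
    by rewrite uv uw vw.
  by rewrite nE addn2 /= !natrM -!natr1 natrM; congr (_ * _); ring.
move=> le; have c3 : 0 < (2 * k%:R + 2) ^+ 2 :> R by rewrite exprn_gt0 //; lra.
rewrite -(ler_pM2l c3) in le.
rewrite [leLHS](_ : _ = (2 * k%:R + 2) ^+ 2 *
  (c ^+ 3 * ((2 * k%:R + 2) * (2 * k%:R + 1) * (2 * k%:R)))); last first.
  by rewrite /c; field.
by apply: le_trans le _; rewrite le_eqVlt; apply/orP; left; apply/eqP; ring.
Qed.

Theorem theorem4p5 (R : realType) (t : nat) (ht : (2 <= t)%N) :
  [/\ forall G : hypergraph,
        uniform 3 G -> ~ subgraph_of (linear_star 3 t) G ->
        lagrangian R G <= lagrangian R (complete 3 (2 * t)),
      exists2 c2 : R, 0 < c2 &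
        forall G : hypergraph,
          uniform 3 G -> ~ subgraph_of (linear_star 3 t) G ->
          covers_pairs G -> ~ isomorphic G (complete 3 (2 * t)) ->
          lagrangian R G <= lagrangian R (complete 3 (2 * t)) - c2
    & lagrangian R (complete 3 (2 * t)) =
        (2 * t%:R - 1) * (t%:R - 1) / (12 * t%:R ^+ 2)].
Proof.
case: t ht => [//|k] k0; have {}k0 : (0 < k)%N by [].
have kR : 0 <= k%:R :> R by [].
have c0 : 0 < 24 * (k%:R + 1) ^+ 2 :> R.
  by rewrite mulr_gt0 // exprn_gt0 //; lra.
set c : R := 24 * (k%:R + 1) ^+ 2 in c0.
(* The complete graph is itself star-free, so the general upper bound applies to it. *)
have KE : c * lagrangian R (complete 3 (2 * k.+1)) = 2 * k%:R * (2 * k%:R + 1).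
  apply/eqP; rewrite eq_le lagrangian_complete_ge andbT.
  apply: lagrangian_star_free_le => //; [exact: complete_uniform|exact: complete_no_star].
split.
- move=> G G3 noL; rewrite -(ler_pM2l c0) KE.
  exact: lagrangian_star_free_le.
(* The gap was obtained for [c] times the Lagrangian, hence the division. *)
- exists (stability_gap R k / c); first by rewrite divr_gt0 // stability_gap_gt0.
  move=> G G3 noL cov noI.
  rewrite -(ler_pM2l c0) mulrBr KE mulrCA divff ?gt_eqF // mulr1.
  exact: lagrangian_star_free_gap.
- apply: (mulfI (lt0r_neq0 c0)); rewrite KE /c -natr1.
  by field; rewrite gt_eqF //; lra.
Qed.
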